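(* Let $F\colon Q^\Delta\to Q^{\Delta'}$ be one of the weighted foldings in the context, with exchange matrices $S$ (of $Q^\Delta$) and $B'$ (of $Q^{\Delta'}$). Let $[k_1],\dots,[k_l]$ be any finite sequence of vertices of $Q^{\Delta'}$. Let $C'$ be the $C$-matrix obtained from $\binom{B'}{I}$ by the mutations $\mu_{[k_1]},\dots,\mu_{[k_l]}$ applied successively, and let $C$ be the $C$-matrix obtained from $\binom{S}{I}$ by the composite mutations $\hat\mu_{[k_1]},\dots,\hat\mu_{[k_l]}$ applied successively. Put $G=(C^T)^{-1}$ and $G'=(C'^T)^{-1}$. Then $$\mathbf d_F(C)=C'\qquad\text{and}\qquad \mathbf d_F(G)=G'.$$ Consequently, $\mathbf d_F$ intertwines composite mutation $\hat\mu_{[k]}$ of $C$- and $G$-matrices of $Q^\Delta$ with mutation $\mu_{[k]}$ of $C$- and $G$-matrices of $Q^{\Delta'}$, and with the map $X\mapsto(X^T)^{-1}$.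
   Context: Foldings: (I) $n\ge2$, $Q^{A_{2n}}$ on vertices $0..2n-1$ with one arrow between $i$ and $i+1$, even vertices all sources (or all sinks), vertex weights $\kappa(i)=U_i(\cos\frac{\pi}{2n+1})$ ($U_k$ Chebyshev of the second kind, $U_k(\cos\alpha)\sin\alpha=\sin(k+1)\alpha$); $Q^{I_2(2n+1)}$ has vertices $[0],[1]$ and one arrow of weight $2\cos\frac{\pi}{2n+1}$ oriented as the arrows from even to odd vertices; $F(i)=[i\bmod 2]$. (H) $m\in\{3,4\}$, $Q^\Delta$ of type $D_6$ ($m=3$) or $E_8$ ($m=4$) on vertices $1..m,\phi_1..\phi_m$, edges $i-(i+1)$, $\phi_i-\phi_{i+1}$ ($i\le m-2$), $(m-1)-\phi_m$, $\phi_{m-1}-m$, $\phi_{m-1}-\phi_m$, all edges between consecutive columns $\{i,\phi_i\},\{i+1,\phi_{i+1}\}$ oriented the same way; $\kappa(i)=1$, $\kappa(\phi_i)=2\cos\frac\pi5$; $Q^{H_m}$ the path $[1]-\cdots-[m]$, weights $1$ except $2\cos\frac\pi5$ on $[m-1]-[m]$, oriented as in $Q^\Delta$; $F(i)=F(\phi_i)=[i]$. In each fibre of $F$ there is exactly one vertex of weight $1$. Exchange matrix of a weighted quiver: $b_{ij}$ = weight of arrow $i\to j$, minus weight of $j\to i$, $0$ otherwise. Mutation $\mu_k$ of $\tilde B=\binom{B}{C}$ ($2N\times N$): $b'_{ij}=-b_{ij}$ if $i=k$ or $j=k$, otherwise $b'_{ij}=b_{ij}+\frac{|b_{ik}|b_{kj}+b_{ik}|b_{kj}|}{2}$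 (for all rows $i$). The lower half after a sequence of mutations starting from $\binom{B}{I}$ is the $C$-matrix. Composite mutation $\hat\mu_{[k]}=\prod_{v:F(v)=[k]}\mu_v$ (these mutations commute). $d_F\colon\mathbb Z^{Q^\Delta_0}\to\mathbb R^{Q^{\Delta'}_0}$, $d_F(v)_{[i]}=\sum_{F(j)=[i]}\kappa(j)v_j$. For a square matrix $X$ indexed by $Q^\Delta_0$ with columns $\mathbf v_j$, $\mathbf d_F(X)$ is the square matrix indexed by $Q^{\Delta'}_0$ whose $[j]$-th column is $d_F(\mathbf v_j)$, where $j$ is the unique vertex with $F(j)=[j]$ and $\kappa(j)=1$. *)

(* Defs.v *)
From HB Require Import structures.
From mathcomp Require Import all_boot all_order all_algebra.
From mathcomp Require Import reals trigo.
Set Implicit Arguments. Unset Strict Implicit. Unset Printing Implicit Defensive.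
Import Order.TTheory GRing.Theory Num.Theory.
Local Open Scope ring_scope.

Section Defs.
Variable R : realType.

(* Exchange matrix of a weighted quiver given by its arrow-weight function
   w i j = weight of the arrow i -> j (0 if there is none). *)
Definition exch_of N (w : 'I_N -> 'I_N -> R) : 'M[R]_N :=
  \matrix_(i, j) (w i j - w j i).

(* Mutation mu_k of an extended (2N x N) matrix (B over C). Row "k" is the
   k-th row of the upper block B. *)
Definition mutate N (k : 'I_N) (M : 'M[R]_(N + N, N)) : 'M[R]_(N + N, N) :=
  \matrix_(i, j)
    if (i == lshift N k) || (j == k) then - M i j
    else M i j + (`|M i k| * M (lshift N k) j + M i k * `|M (lshift N k) j|) / 2.

(* Composite mutation hat-mu_[k] = product of mu_v over the fibre F^{-1}([k])
   (these mutations commute; we apply them in the order of enum). *)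
Definition comp_mutate N N' (F : 'I_N -> 'I_N') (k : 'I_N') (M : 'M[R]_(N + N, N)) :=
  foldr (@mutate N) M [seq v <- enum 'I_N | F v == k].

Definition Cmat N (B : 'M[R]_N) (ks : seq 'I_N) : 'M[R]_N :=
  dsubmx (foldl (fun M k => mutate k M) (col_mx B 1%:M) ks).

Definition Cmat_comp N N' (F : 'I_N -> 'I_N') (S : 'M[R]_N) (ks : seq 'I_N') : 'M[R]_N :=
  dsubmx (foldl (fun M k => comp_mutate F k M) (col_mx S 1%:M) ks).

Definition Gmat N (C : 'M[R]_N) : 'M[R]_N := invmx C^T.

(* d_F of a vector v in Z^{Q^Delta_0}: d_F(v)_[i] = sum_{F j = [i]} kappa j v_j;
   bold d_F of a square matrix X: the [b]-th column is d_F of the column of X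
   indexed by rep b, the unique vertex of weight 1 in the fibre of [b]. *)
Definition dF_vec N N' (F : 'I_N -> 'I_N') (kap : 'I_N -> R) (v : 'cV[R]_N) : 'cV[R]_N' :=
  \col_a \sum_(j | F j == a) kap j * v j 0.

Definition dF N N' (F : 'I_N -> 'I_N') (kap : 'I_N -> R) (rep : 'I_N' -> 'I_N)
  (X : 'M[R]_N) : 'M[R]_N' :=
  \matrix_(a, b) (dF_vec F kap (col (rep b) X)) a 0.

Fixpoint chebU (k : nat) (x : R) : R :=
  match k with
  | 0 => 1
  | S k' => match k' with
            | 0 => 2 * x
            | S k'' => 2 * x * chebU k' x - chebU k'' x
            end
  end.

(* vertices 0..2n-1 of Q^{A_2n}; src = true: even vertices are sources,
   src = false: even vertices are sinks. *)
Definition arrA (n : nat) (src : bool) (i j : 'I_(n.*2)) : R :=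
  if ((i.+1 == j :> nat) || (j.+1 == i :> nat)) && (~~ odd i == src) then 1 else 0.

Definition SI n src : 'M[R]_(n.*2) := exch_of (@arrA n src).

(* Q^{I_2(2n+1)}: vertices [0],[1]; one arrow of weight 2cos(pi/(2n+1)),
   from [0] to [1] iff the arrows of Q^{A_2n} go from even to odd vertices. *)
Definition arrI2 (n : nat) (src : bool) (a b : 'I_2) : R :=
  if (a != b) && ((a == 0 :> nat) == src) then 2 * cos (pi / ((n.*2).+1)%:R) else 0.

Definition BI n src : 'M[R]_2 := exch_of (@arrI2 n src).

Lemma modn2_lt (i : nat) : ((i %% 2) < 2)%N. Proof. by rewrite ltn_pmod. Qed.
Definition FI n (i : 'I_(n.*2)) : 'I_2 := Ordinal (modn2_lt i).

Definition kapI n (i : 'I_(n.*2)) : R := chebU i (cos (pi / ((n.*2).+1)%:R)).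

Lemma repI_lt0 n : (2 <= n)%N -> (0 < n.*2)%N.
Proof. by move=> h; rewrite double_gt0 (leq_trans _ h). Qed.
Lemma repI_lt1 n : (2 <= n)%N -> ((n.*2).-1 < n.*2)%N.
Proof. by move=> h; rewrite prednK // repI_lt0. Qed.

(* the unique vertex of weight 1 in each fibre: 0 in [0] (U_0 = 1) and
   2n-1 in [1] (U_{2n-1}(cos(pi/(2n+1))) = 1). *)
Definition repI n (hn : (2 <= n)%N) (b : 'I_2) : 'I_(n.*2) :=
  if b == 0 :> nat then Ordinal (repI_lt0 hn) else Ordinal (repI_lt1 hn).

(* ---------- folding (H): D_6 -> H_3 (m=3), E_8 -> H_4 (m=4) ---------- *)
(* vertex lshift m c is the vertex c+1, vertex rshift m c is phi_{c+1}
   (columns c = 0..m-1).  dir c (c <= m-2): true iff all edges between the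
   columns c and c+1 are oriented from column c to column c+1. *)
Definition colH m (v : 'I_(m + m)) : 'I_m :=
  match split v with inl c => c | inr c => c end.
Definition isphi m (v : 'I_(m + m)) : bool :=
  match split v with inl _ => false | inr _ => true end.

Definition edgeH m (u v : 'I_(m + m)) : bool :=
  ((colH u).+1 == colH v :> nat) &&
  (if ((colH u).+2 < m)%N then isphi u == isphi v else isphi u || isphi v).

Definition arrH m (dir : nat -> bool) (u v : 'I_(m + m)) : R :=
  if (edgeH u v && dir (colH u)) || (edgeH v u && ~~ dir (colH v)) then 1 else 0.

Definition SH m dir : 'M[R]_(m + m) := exch_of (@arrH m dir).

Definition arrHm m (dir : nat -> bool) (a b : 'I_m) : R :=
  let w c := if (c.+2 == m)%N then 2 * cos (pi / 5%:R) else 1 in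
  if (a.+1 == b :> nat) && dir a then w (nat_of_ord a)
  else if (b.+1 == a :> nat) && ~~ dir b then w (nat_of_ord b) else 0.

Definition BH m dir : 'M[R]_m := exch_of (@arrHm m dir).

Definition kapH m (v : 'I_(m + m)) : R := if isphi v then 2 * cos (pi / 5%:R) else 1.

Definition repH m (b : 'I_m) : 'I_(m + m) := lshift m b.

End Defs.

Inductive context_folding (R : realType) :
  forall N N', ('I_N -> 'I_N') -> ('I_N -> R) -> ('I_N' -> 'I_N) ->
               'M[R]_N -> 'M[R]_N' -> Prop :=
| FoldI (n : nat) (hn : (2 <= n)%N) (src : bool) :
    context_folding (@FI n) (@kapI R n) (repI hn) (SI R n src) (BI R n src)
| FoldH (m : nat) (hm : (m == 3)%N || (m == 4)%N) (dir : nat -> bool) :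
    context_folding (@colH m) (@kapH R m) (@repH m) (SH R m dir) (BH R m dir).

(* Main.v *)
Require Import Defs.
From HB Require Import structures.
From Stdlib Require Import BinInt.
From mathcomp Require Import all_boot all_order all_algebra.
From mathcomp Require Import ssrZ zify ring lra.
From mathcomp Require Import reals trigo.
Set Implicit Arguments. Unset Strict Implicit. Unset Printing Implicit Defensive.
Import Order.TTheory GRing.Theory Num.Theory.
Local Open Scope ring_scope.

(** Let K be the N' x N matrix with K a i = kap i when F i = a and 0 otherwise.
    The proof propagates K B = B' K, K C = C' K and K G = G' K along mutations;
    restricting to the columns of the vertices of weight 1 gives the theorem.
    If the C-columns of the fibre of [k] all have the sign e, then mutation at
    [k] acts by B := E^T B E, C := C E, G := G E^T for an involution E built from
    B and e, likewise with E' below, and K E = E' K, K E^T = E'^T K hold as soon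
    as the entries of B have constant sign along fibres.

    The sign-coherence needed upstairs is checked on an explicit set of seeds of
    Q^Delta.  For A_2n the composite mutations run along the bipartite belt,
    whose c-vectors are the roots eps_a - eps_b, where a and b move one step per
    mutation around a cycle of length 2n+1.  For D_6 and E_8 all matrices are
    m x m matrices over Z[phi] (phi the golden ratio) written in the Z-basis
    1, phi, and the 32, resp. 280, seeds up to relabelling are enumerated for
    each orientation. *)

(** * The folding theorem for a mutation-closed set of sign-coherent seeds *)

Section PositivePart.
Variable R : realType.
Implicit Types x y e : R.

Definition pospart x : R := (x + `|x|) / 2.

Lemma pospart0 : pospart 0 = 0. Proof. by rewrite /pospart normr0 addr0 mul0r. Qed.

Lemma pospartMr x y : 0 <= y -> pospart (x * y) = pospart x * y.
Proof. by move=> y0; rewrite /pospart normrM (ger0_norm y0) -mulrDl mulrAC. Qed.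

Lemma norm_sum_coherent (I : finType) (P : pred I) (f : I -> R) :
  (forall i j, P i -> P j -> 0 <= f i * f j) ->
  `|\sum_(i | P i) f i| = \sum_(i | P i) `|f i|.
Proof.
move=> coh; have [/existsP[i /andP[Pi fi]]|/existsPn all0] :=
  boolP [exists i, P i && (f i != 0)].
  have [f_gt0|f_le0] := ltP 0 (f i).
    have f_ge0 j : P j -> 0 <= f j by move=> Pj; have := coh _ _ Pi Pj; rewrite pmulr_rge0.
    rewrite ger0_norm ?sumr_ge0//; apply: eq_bigr => j Pj.
    by rewrite ger0_norm ?f_ge0.
  have f_lt0 : f i < 0 by rewrite lt_neqAle fi.
  have f_ge0 j : P j -> f j <= 0 by move=> Pj; have := coh _ _ Pi Pj; rewrite nmulr_rge0.
  rewrite ler0_norm ?sumr_le0// -sumrN; apply: eq_bigr => j Pj.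
  by rewrite ler0_norm ?f_ge0.
have f0 j : P j -> f j = 0.
  by move=> Pj; move: (all0 j); rewrite Pj /= negbK => /eqP.
by rewrite !big1 ?normr0// => j Pj; rewrite f0 ?normr0.
Qed.

Lemma pospart_sum_coherent (I : finType) (P : pred I) (f : I -> R) :
  (forall i j, P i -> P j -> 0 <= f i * f j) ->
  pospart (\sum_(i | P i) f i) = \sum_(i | P i) pospart (f i).
Proof.
move=> coh; rewrite /pospart norm_sum_coherent// -big_split /= mulr_suml.
by apply: eq_bigr.
Qed.

End PositivePart.

(** * Composite mutation along a fibre as a matrix product *)

Section FibreMutation.
Variables (R : realType) (N N' : nat) (F : 'I_N -> 'I_N').
Implicit Types (B C : 'M[R]_N) (k : 'I_N') (e : R).

Definition fibre_free B := forall i j, F i = F j -> B i j = 0.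

Definition fibre_coherent B :=
  forall i i' j, F i = F i' -> 0 <= B i j * B i' j.

Definition mutB k B : 'M[R]_N := \matrix_(i, j)
  if (F i == k) || (F j == k) then - B i j
  else B i j + \sum_(v | F v == k) (`|B i v| * B v j + B i v * `|B v j|) / 2.

Definition mutC k B C : 'M[R]_N := \matrix_(i, j)
  if F j == k then - C i j
  else C i j + \sum_(v | F v == k) (`|C i v| * B v j + C i v * `|B v j|) / 2.

(** For [F = id] this is the usual elementary matrix of tropical sign [e] through which a single
    mutation acts; here all rows of a fibre are changed at once. *)
Definition mutE k B e : 'M[R]_N := \matrix_(i, j)
  if F i == k then - (i == j)%:R + pospart (e * B i j) else (i == j)%:R.

Definition sign_coherent_at k e C := forall i v, F v = k -> 0 <= e * C i v.

(** Induction on the list: [B] vanishes inside the fibre, so the mutations at [s] leave the row and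
    the column of a further fibre vertex [w] unchanged, and the contributions of the vertices simply
    add up. *)
Lemma foldr_mutate (s : seq 'I_N) k (M : 'M[R]_(N + N, N)) :
  fibre_free (usubmx M) -> uniq s -> (forall v, v \in s -> F v = k) ->
  forall i j,
  foldr (@mutate R N) M s i j =
    if (j \in s) || (i \in [seq lshift N v | v <- s]) then - M i j
    else M i j + \sum_(v <- s) (`|M i v| * M (lshift N v) j
                                + M i v * `|M (lshift N v) j|) / 2.
Proof.
move=> free; have M0 v w : F v = F w -> M (lshift N v) w = 0.
  by move=> Fvw; have := free v w Fvw; rewrite mxE.
elim: s => [|w s IHs] /= => [_ _ i j|/andP[ws us] sk i j].
  by rewrite big_nil addr0.
have {}sk' v : v \in s -> F v = k by move=> vs; rewrite sk // inE vs orbT.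
have Fw : F w = k by rewrite sk // mem_head.
have {}IHs := IHs us sk'.
have inl (v : 'I_N) : (lshift N v \in [seq lshift N u | u <- s]) = (v \in s).
  by rewrite mem_map //; exact: lshift_inj.
have col_w u : foldr (@mutate R N) M s u w = M u w.
  rewrite IHs (negPf ws) /=; case: ifP => [/mapP[v vs ->]|_].
    by rewrite M0 ?oppr0 // (sk' v) ?Fw.
  rewrite big_seq big1 ?addr0 // => v vs.
  by rewrite M0 ?normr0 ?mulr0 ?addr0 ?mul0r // (sk' v) ?Fw.
have row_w u : foldr (@mutate R N) M s (lshift N w) u = M (lshift N w) u.
  rewrite IHs inl (negPf ws) orbF; case: ifP => [us'|_].
    by rewrite M0 ?oppr0 // (sk' u) ?Fw.
  rewrite big_seq big1 ?addr0 // => v vs.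
  by rewrite (M0 w v) ?normr0 ?mul0r ?addr0 ?mul0r // (sk' v) ?Fw.
rewrite mxE col_w row_w in_cons (in_cons (lshift N w)).
have [->|iw] := eqVneq i (lshift N w); first by rewrite orbT row_w.
have [->|jw] := eqVneq j w; first by rewrite /= col_w.
rewrite /= IHs; case: ifP => [/orP[js|/mapP[v vs ->]]|_].
- by rewrite (M0 w j) ?normr0 ?mulr0 ?addr0 ?mul0r ?addr0 // (sk' j) ?Fw.
- by rewrite (M0 v w) ?normr0 ?mul0r ?addr0 ?mul0r ?addr0 // (sk' v) ?Fw.
by rewrite big_cons addrA addrAC.
Qed.

Lemma comp_mutateE k B C : fibre_free B ->
  comp_mutate F k (col_mx B C) = col_mx (mutB k B) (mutC k B C).
Proof.
move=> free; apply/matrixP => i j.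
have Fs v : v \in [seq v <- enum 'I_N | F v == k] = (F v == k).
  by rewrite mem_filter mem_enum andbT.
rewrite /comp_mutate (@foldr_mutate _ k); first last.
- by move=> v; rewrite Fs => /eqP.
- by rewrite filter_uniq // enum_uniq.
- by rewrite col_mxKu.
have sumE (f : 'I_N -> R) :
    \sum_(v <- [seq v <- enum 'I_N | F v == k]) f v = \sum_(v | F v == k) f v.
  by rewrite big_filter big_enum_cond.
rewrite sumE Fs; case: (split_ordP i) => {i} i ->.
  rewrite !col_mxEu mem_map; last exact: lshift_inj.
  rewrite Fs orbC [RHS]mxE; case: ifP => // _; congr (_ + _).
  by apply: eq_bigr => v _; rewrite !col_mxEu.
rewrite !col_mxEd [RHS]mxE (_ : rshift N i \in _ = false); last first.
  by apply/mapP => -[v _ /eqP]; rewrite eq_rlshift.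
rewrite orbF; case: ifP => //= _.
by congr (_ + _); apply: eq_bigr => v _; rewrite !col_mxEu !col_mxEd.
Qed.

(** Write [E = J + P] with [J] diagonal of entries 1 and -1, and [P] supported on rows in the fibre
    and columns outside it. Then [P P = 0] and [J P = - P J]. *)
Lemma mutE_sq k B e : fibre_free B -> mutE k B e *m mutE k B e = 1%:M.
Proof.
move=> free; apply/matrixP => i j; rewrite !mxE.
under eq_bigr do rewrite !mxE.
have [Fi|Fi] := eqVneq (F i) k; last first.
  rewrite (bigD1 i) //= big1 ?addr0 => [|v vi]; first by rewrite eqxx (negPf Fi) mul1r.
  by rewrite eq_sym (negPf vi) mul0r.
have B0 v : F v = k -> B i v = 0 by move=> Fv; rewrite free // Fi Fv.
rewrite (bigD1 i) //= eqxx Fi eqxx B0 // mulr0 pospart0 addr0 mulrDr mulN1r opprK mulN1r.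
have [ij|ij] := eqVneq i j.
  rewrite big1 => [|v vi]; first by rewrite -ij B0 // mulr0 pospart0 oppr0 !addr0.
  rewrite eq_sym (negPf vi) oppr0 add0r; case: ifP => [/eqP Fv|_].
    by rewrite B0 // mulr0 pospart0 mul0r.
  by rewrite -ij (negPf vi) mulr0.
rewrite add0r (bigD1 j) /=; last by rewrite eq_sym.
rewrite eqxx (negPf ij) oppr0 add0r big1 => [|v /andP[vi vj]].
  rewrite addr0; case: ifP => [/eqP Fj|_]; last by rewrite mulr1 addNr.
  by rewrite B0 // mulr0 pospart0 mul0r oppr0 addr0.
rewrite [i == v]eq_sym (negPf vi) oppr0 add0r; case: ifP => [/eqP Fv|_].
  by rewrite B0 // mulr0 pospart0 mul0r.
by rewrite (negPf vj) mulr0.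
Qed.

Lemma mulmx_mutE k B e m (X : 'M[R]_(m, N)) i j : fibre_free B ->
  (X *m mutE k B e) i j =
  if F j == k then - X i j
  else X i j + \sum_(v | F v == k) X i v * pospart (e * B v j).
Proof.
move=> free; rewrite mxE.
transitivity ((if F j == k then - X i j else X i j)
              + \sum_(v | F v == k) X i v * pospart (e * B v j)).
  rewrite [in RHS]big_mkcond /= (bigD1 j) //= [in RHS](bigD1 j) //= addrA.
  congr (_ + _).
    by rewrite mxE eqxx; case: ifP => _; rewrite ?mulr1 ?addr0 // mulrDr mulrN1.
  apply: eq_bigr => v vj; rewrite mxE (negPf vj) oppr0 add0r.
  by case: ifP => _; rewrite ?mulr0.
case: ifP => // /eqP Fj; rewrite big1 ?addr0 // => v /eqP Fv.
by rewrite free ?mulr0 ?pospart0 ?mulr0 // Fv.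
Qed.

(** Sign-coherence gives [|c| = e c], whence [(|c| b + c |b|) / 2 = c * pospart (e * b)]. *)
Lemma mutC_mutE k B C e : e = 1 \/ e = -1 -> fibre_free B ->
  sign_coherent_at k e C -> mutC k B C = C *m mutE k B e.
Proof.
move=> e1 free sgn; apply/matrixP => i j; rewrite mulmx_mutE // mxE.
case: ifP => // _; congr (_ + _); apply: eq_bigr => v /eqP Fv.
have := sgn i v Fv; rewrite /pospart.
case: e1 => ->; rewrite ?mul1r ?mulN1r => Cv.
  by rewrite ger0_norm // -mulrDr -mulrA.
by rewrite ler0_norm -?oppr_ge0 // mulNr -mulrN -mulrDr -mulrA normrN.
Qed.

(** Both signs work, since [(|x| y + x |y|) / 2 = pospart (- e * x) * y + x * pospart (e * y)], used
    with [x = B i v] and [y = B v j]. Products of two correction terms vanish because [B] is zero on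
    the fibre. *)
Lemma mutB_mutE k B e : e = 1 \/ e = -1 -> fibre_free B -> B^T = - B ->
  mutB k B = (mutE k B e)^T *m B *m mutE k B e.
Proof.
move=> e1 free skew; apply/matrixP => i j.
have BT u v : B v u = - B u v.
  by have /matrixP/(_ u v) := skew; rewrite !mxE.
have row_e u v : ((mutE k B e)^T *m B) u v =
   if F u == k then - B u v else B u v + \sum_(w | F w == k) pospart (e * B w u) * B w v.
  rewrite -[B in _ *m B]trmxK -trmx_mul mxE mulmx_mutE // mxE.
  case: ifP => // _; congr (_ + _); apply: eq_bigr => w _.
  by rewrite mxE mulrC.
rewrite mulmx_mutE // !row_e mxE.
have [Fi|Fi] := eqVneq (F i) k; have [Fj|Fj] := eqVneq (F j) k => /=.
- by rewrite free ?oppr0 // Fi.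
- rewrite big1 ?addr0 // => v /eqP Fv.
  by rewrite row_e Fi eqxx free ?oppr0 ?mul0r // Fi.
- rewrite big1 ?addr0 // => v /eqP Fv.
  by rewrite (free v j) ?mulr0 // Fv Fj.
rewrite -addrA; congr (_ + _); rewrite -big_split /=.
apply: eq_bigr => v /eqP Fv; rewrite row_e (negPf Fi) big1 ?addr0 => [|w /eqP Fw]; last first.
  by rewrite (free w v) ?mulr0 // Fv.
rewrite (BT i v) /pospart.
by case: e1 => ->; rewrite ?mul1r ?mulN1r ?opprK ?normrN; field.
Qed.

End FibreMutation.

(** Ordinary mutation becomes the case [F = id], so the same lemmas serve both sides of the
    folding. *)
Lemma comp_mutate_id (R : realType) N (k : 'I_N) (M : 'M[R]_(N + N, N)) :
  comp_mutate id k M = mutate k M.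
Proof.
rewrite /comp_mutate; have -> : [seq v <- enum 'I_N | v == k] = [:: k] => //.
by rewrite filter_pred1_uniq ?enum_uniq ?mem_enum.
Qed.

Lemma comp_mutate_col_mx (R : realType) N N' (F : 'I_N -> 'I_N') k (B C : 'M[R]_N) e :
  e = 1 \/ e = -1 -> fibre_free F B -> B^T = - B -> sign_coherent_at F k e C ->
  comp_mutate F k (col_mx B C) =
  col_mx ((mutE F k B e)^T *m B *m mutE F k B e) (C *m mutE F k B e).
Proof.
by move=> *; rewrite comp_mutateE // (@mutB_mutE _ _ _ F k B e) // (@mutC_mutE _ _ _ F k B C e).
Qed.

(** * Intertwining the mutation matrices of the two quivers *)

Section Folding.
Variables (R : realType) (N N' : nat) (F : 'I_N -> 'I_N') (kap : 'I_N -> R).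

Definition fold_mx : 'M[R]_(N', N) := \matrix_(a, i) (kap i *+ (F i == a)).

Lemma fold_mulmx m (X : 'M[R]_(N, m)) a j :
  (fold_mx *m X) a j = \sum_(i | F i == a) kap i * X i j.
Proof.
rewrite mxE [RHS]big_mkcond /=; apply: eq_bigr => i _.
by rewrite mxE; case: (F i == a); rewrite ?mul0r.
Qed.

Lemma mulmx_fold m (X : 'M[R]_(m, N')) a j :
  (X *m fold_mx) a j = X a (F j) * kap j.
Proof.
rewrite mxE (bigD1 (F j)) //= mxE eqxx big1 ?addr0 // => b bj.
by rewrite mxE eq_sym (negPf bj) mulr0.
Qed.

Hypothesis kap_ge0 : forall i, 0 <= kap i.
Variables (B : 'M[R]_N) (B' : 'M[R]_N').
Hypotheses (coh : fibre_coherent F B) (KB : fold_mx *m B = B' *m fold_mx).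

(** Along the fibre of [a] the entries of column [j] share a sign and the weights are nonnegative,
    so the positive part passes through the weighted sum, which [KB] evaluates. *)
Lemma fold_pospart a j e :
  \sum_(i | F i == a) kap i * pospart (e * B i j) = kap j * pospart (e * B' a (F j)).
Proof.
rewrite mulrC -pospartMr // -mulrA -mulmx_fold -KB fold_mulmx mulr_sumr pospart_sum_coherent.
  by apply: eq_bigr => i _; rewrite mulrC -pospartMr // -mulrA [B i j * _]mulrC.
move=> i i' /eqP Fi /eqP Fi'.
have -> : e * (kap i * B i j) * (e * (kap i' * B i' j)) =
  e ^+ 2 * (kap i * kap i') * (B i j * B i' j) by ring.
by rewrite mulr_ge0 ?coh ?Fi // mulr_ge0 ?sqr_ge0 // mulr_ge0.
Qed.

Lemma fold_mutE k e : fold_mx *m mutE F k B e = mutE id k B' e *m fold_mx.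
Proof.
apply/matrixP => a j; rewrite fold_mulmx mulmx_fold.
under eq_bigr do rewrite mxE.
rewrite mxE; have [->|ak] := eqVneq a k.
  rewrite (eq_bigr (fun i => kap i * - (i == j)%:R + kap i * pospart (e * B i j))); last first.
    by move=> i ->; rewrite mulrDr.
  rewrite big_split /= fold_pospart mulrDl [kap j * pospart _]mulrC; congr (_ + _).
  rewrite big_mkcond (bigD1 j) //= eqxx big1 => [|i ij].
    by rewrite addr0 eq_sym; case: ifP; rewrite ?mulrN1 ?mulN1r // oppr0 mul0r.
  by rewrite (negPf ij) oppr0 mulr0 if_same.
rewrite (eq_bigr (fun i => kap i * (i == j)%:R)) => [|i /eqP Fi]; last first.
  by rewrite Fi (negPf ak).
rewrite big_mkcond (bigD1 j) //= eqxx big1 => [|i ij].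
  by rewrite addr0 eq_sym mulr1; case: ifP; rewrite ?mul1r ?mul0r.
by rewrite (negPf ij) mulr0 if_same.
Qed.

Hypotheses (skew : B^T = - B) (skew' : B'^T = - B').

(** Skew-symmetry on both sides turns the transposed entries into those for the opposite sign, so
    [fold_pospart] applies with [- e]. *)
Lemma fold_mutE_tr k e :
  fold_mx *m (mutE F k B e)^T = (mutE id k B' e)^T *m fold_mx.
Proof.
apply/matrixP => a j; rewrite fold_mulmx mulmx_fold.
under eq_bigr do rewrite !mxE.
rewrite !mxE.
have [Fj|Fj] := eqVneq (F j) k; last first.
  rewrite big_mkcond (bigD1 j) //= eqxx big1 => [|i ij].
    by rewrite addr0 mulr1; case: ifP; rewrite ?mul1r ?mul0r.
  by rewrite [j == i]eq_sym (negPf ij) mulr0 if_same.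
have skewE u v : e * B u v = - e * B v u.
  by have /matrixP/(_ v u) := skew; rewrite !mxE => ->; rewrite mulrN mulNr.
have skewE' : e * B' (F j) a = - e * B' a (F j).
  by have /matrixP/(_ a (F j)) := skew'; rewrite !mxE => ->; rewrite mulrN mulNr.
rewrite (eq_bigr (fun i => kap i * - (i == j)%:R + kap i * pospart (- e * B i j))); last first.
  by move=> i _; rewrite mulrDr skewE [j == i]eq_sym.
rewrite big_split /= fold_pospart skewE' mulrDl [kap j * pospart _]mulrC; congr (_ + _).
rewrite big_mkcond (bigD1 j) //= eqxx big1 => [|i ij].
  by rewrite addr0; case: ifP; rewrite ?mulrN1 ?mulN1r // oppr0 mul0r.
by rewrite (negPf ij) oppr0 mulr0 if_same.
Qed.

End Folding.

Lemma fibre_free_id (R : realType) N (B : 'M[R]_N) : B^T = - B -> fibre_free id B.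
Proof.
by move=> /matrixP skew i _ <-; have := skew i i; rewrite !mxE; lra.
Qed.

Lemma skew_congr (R : realType) N (B E : 'M[R]_N) :
  B^T = - B -> (E^T *m B *m E)^T = - (E^T *m B *m E).
Proof. by move=> skew; rewrite !trmx_mul trmxK skew mulNmx mulmxN mulmxA. Qed.

(** * Propagation of the intertwining relations along mutation sequences *)

Section FoldingTheorem.
Variables (R : realType) (N N' : nat) (F : 'I_N -> 'I_N') (kap : 'I_N -> R)
  (rep : 'I_N' -> 'I_N) (S : 'M[R]_N) (B' : 'M[R]_N').
Hypotheses (kap_ge0 : forall i, 0 <= kap i)
  (F_rep : forall b, F (rep b) = b) (kap_rep : forall b, kap (rep b) = 1)
  (skew' : B'^T = - B') (KS : fold_mx F kap *m S = B' *m fold_mx F kap).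

Variable seed : 'M[R]_N -> 'M[R]_N -> Prop.
Hypotheses (seed0 : seed S 1%:M)
  (seed_skew : forall B C, seed B C -> B^T = - B)
  (seed_free : forall B C, seed B C -> fibre_free F B)
  (seed_coherent : forall B C, seed B C -> fibre_coherent F B)
  (seed_step : forall B C k, seed B C -> exists e, [/\ e = 1 \/ e = -1,
     sign_coherent_at F k e C & seed (mutB F k B) (mutC F k B C)]).

Let K := fold_mx F kap.

Lemma dF_intertwine (X : 'M[R]_N) (X' : 'M[R]_N') :
  K *m X = X' *m K -> dF F kap rep X = X'.
Proof.
move=> KX; apply/matrixP => a b; rewrite !mxE.
under eq_bigr do rewrite mxE.
by rewrite -(fold_mulmx F kap X) -/K KX mulmx_fold F_rep kap_rep mulr1.
Qed.

(** The starting seed is arbitrary so that induction on [ks] applies. The G-matrices are carried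
    along, characterised by [C^T G = 1], and are identified with [Gmat] only at the end. *)
Lemma folding_invariant ks (B C : 'M[R]_N) (Bf Cf : 'M[R]_N') (G : 'M[R]_N) (Gf : 'M[R]_N') :
  seed B C -> Bf^T = - Bf -> K *m B = Bf *m K -> K *m C = Cf *m K ->
  K *m G = Gf *m K -> C^T *m G = 1%:M -> Cf^T *m Gf = 1%:M ->
  let C1 := dsubmx (foldl (fun M k => comp_mutate F k M) (col_mx B C) ks) in
  let Cf1 := dsubmx (foldl (fun M k => mutate k M) (col_mx Bf Cf) ks) in
  dF F kap rep C1 = Cf1 /\ dF F kap rep (Gmat C1) = Gmat Cf1.
Proof.
elim: ks B C Bf Cf G Gf => [|k ks IHks] B C Bf Cf G Gf sBC skf KB KC KG CG CGf /=.
  rewrite !col_mxKd; split; first exact: dF_intertwine.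
  have inv_uniq n (X Y : 'M[R]_n) : X^T *m Y = 1%:M -> Gmat X = Y.
    move=> XY; have [uX _] := mulmx1_unit XY.
    by rewrite /Gmat -[LHS]mulmx1 -XY mulKmx.
  by rewrite (inv_uniq _ _ _ CG) (inv_uniq _ _ _ CGf); apply: dF_intertwine.
have [e [e1 sgn]] := seed_step k sBC.
have skB := seed_skew sBC; have frB := seed_free sBC; have coB := seed_coherent sBC.
(* Sign-coherence downstairs is inherited: as [rep k] has weight 1, column [k] of [Cf] is [K]
   applied to column [rep k] of [C], and [K] has nonnegative entries. *)
have sgn' : sign_coherent_at id k e Cf.
  move=> i _ ->.
  rewrite -[Cf i k]mulr1 -(kap_rep k) -{1}(F_rep k) -(mulmx_fold F kap Cf) -/K -KC.
  rewrite fold_mulmx mulr_sumr sumr_ge0 // => j _.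
  by rewrite mulrCA mulr_ge0 // sgn // F_rep.
have frBf := fibre_free_id skf.
rewrite (mutB_mutE k e1)// (mutC_mutE e1)//.
rewrite -(comp_mutate_id k) !(@comp_mutate_col_mx _ _ _ _ k _ _ e)//.
have KE := fold_mutE kap_ge0 coB KB k e.
have KET := fold_mutE_tr kap_ge0 coB KB skB skf k e.
set E := mutE F k B e in KE KET *; set Ef := mutE id k Bf e in KE KET *.
(* Since [E] is an involution, the transposed inverse of [C E] is [G E^T]. *)
move=> sBC1; apply: (IHks _ _ _ _ (G *m E^T) (Gf *m Ef^T)) => //.
- exact: skew_congr.
- by rewrite !mulmxA KET -!mulmxA (mulmxA _ B) KB -!mulmxA KE.
- by rewrite mulmxA KC -mulmxA KE mulmxA.
- by rewrite mulmxA KG -mulmxA KET mulmxA.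
- by rewrite trmx_mul mulmxA -[_ *m G]mulmxA CG mulmx1 -trmx_mul mutE_sq // trmx1.
- by rewrite trmx_mul mulmxA -[_ *m Gf]mulmxA CGf mulmx1 -trmx_mul mutE_sq // trmx1.
Qed.

Lemma folding_theorem ks :
  dF F kap rep (Cmat_comp F S ks) = Cmat B' ks /\
  dF F kap rep (Gmat (Cmat_comp F S ks)) = Gmat (Cmat B' ks).
Proof.
apply: (@folding_invariant ks S 1%:M B' 1%:M 1%:M 1%:M) => //.
- by rewrite mulmx1 mul1mx.
- by rewrite mulmx1 mul1mx.
- by rewrite trmx1 mulmx1.
- by rewrite trmx1 mulmx1.
Qed.

End FoldingTheorem.

(** * Foldings onto H_3 and H_4 *)

(* The pair (x, y) stands for x + y phi, where phi ^ 2 = phi + 1. *)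
Definition zphi : Type := (Z * Z)%type.

Definition zzero : zphi := (Z0, Z0).
Definition zone : zphi := (Z.one, Z0).
Definition zgold : zphi := (Z0, Z.one).

Definition zopp (z : zphi) : zphi := (Z.opp z.1, Z.opp z.2).
Definition zadd (z w : zphi) : zphi := (Z.add z.1 w.1, Z.add z.2 w.2).
Definition zmul (z w : zphi) : zphi :=
  (Z.add (Z.mul z.1 w.1) (Z.mul z.2 w.2),
   Z.add (Z.mul z.1 w.2) (Z.add (Z.mul z.2 w.1) (Z.mul z.2 w.2))).
Definition znonneg (z : zphi) := Z.leb Z0 z.1 && Z.leb Z0 z.2.
Definition znonpos (z : zphi) := Z.leb z.1 Z0 && Z.leb z.2 Z0.
(* (|z| w + z |w|) / 2 for z and w each having coordinates of one sign. *)
Definition zmulc (z w : zphi) : zphi :=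
  if znonneg z && znonneg w then zmul z w
  else if znonpos z && znonpos w then zopp (zmul z w) else zzero.

(* Rows of the 2m x m extended matrix: m rows of B, then m rows of C. *)
Definition zstate := seq (seq zphi).

(** * Enumeration of seeds over Z[phi] *)

Section ZStates.
Variable m : nat.
Implicit Types (st : zstate) (L : seq zstate) (q : seq nat) (ds : seq bool).

Definition zentry st i j : zphi := nth zzero (nth [::] st i) j.

Definition zmut k st : zstate :=
  mkseq (fun i => mkseq (fun j =>
    if (i == k) || (j == k) then zopp (zentry st i j)
    else zadd (zentry st i j) (zmulc (zentry st i k) (zentry st k j))) m) (m + m)%N.

(** Relabelling moves the rows and columns of [B] but only the columns of [C], whose rows stay
    indexed by the initial vertices. *)
Definition zperm q st : zstate :=
  mkseq (fun i => mkseq (fun j =>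
    zentry st (if (i < m)%N then nth 0%N q i else i) (nth 0%N q j)) m) (m + m)%N.

Definition zinit ds : zstate :=
  mkseq (fun i => mkseq (fun j =>
    let w c : zphi := if (c.+2 < m)%N then zone else zgold in
    if i.+1 == j then (if nth false ds i then w i else zopp (w i))
    else if (j.+1 == i) && (i < m)%N then (if nth false ds j then zopp (w j) else w j)
    else if i == (m + j)%N then zone else zzero) m) (m + m)%N.

(* Any key separating the columns of C would do: it only serves to choose a
   canonical labelling, and [zmem] checks the outcome. *)
Definition zkey st j : Z :=
  foldr (fun i acc => let z := zentry st (m + i) j in
    Z.add (Z.mul (Zpos 16) (Z.add (Z.mul (Zpos 16) acc) z.1)) z.2) Z0 (iota 0 m).

Definition zranks st : seq nat :=
  let keys := mkseq (zkey st) m in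
  [seq count (fun y => Z.ltb y x) keys | x <- keys].

Definition zcanon st : zstate :=
  let q := zranks st in zperm (mkseq (fun a => index a q) m) st.

Definition zmem L st : bool :=
  let q := zranks st in let st' := zcanon st in
  [&& st' \in L, zperm q st' == st, uniq q, size q == m & all (fun a => (a < m)%N) q].

(** Signs are tested on both coordinates, which is stronger than fixing the sign of the real number
    [x + y phi]: it makes every entry of the blown-up 2 x 2 block have that sign. *)
Definition zgood st : bool :=
  [&& all (fun i => all (fun j =>
        [&& zentry st i j == zopp (zentry st j i), (i != j) || (zentry st i j == zzero)
          & znonneg (zentry st i j) || znonpos (zentry st i j)])
      (iota 0 m)) (iota 0 m)
    & all (fun j => all (fun i => znonneg (zentry st (m + i) j)) (iota 0 m)
                 || all (fun i => znonpos (zentry st (m + i) j)) (iota 0 m)) (iota 0 m)].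

(** Breadth-first search. Its correctness need not be proved, because [zclosed] tests the list that
    it returns. *)
Fixpoint zexplore fuel frontier L : seq zstate :=
  if fuel is n.+1 then
    let new := foldr (fun st acc => if (st \in acc) || (st \in L) then acc else st :: acc)
      [::] [seq zcanon (zmut k st) | st <- frontier, k <- iota 0 m] in
    zexplore n new (new ++ L)
  else L.

Definition zclosed L : bool :=
  all (fun st => zgood st && all (fun k => zmem L (zmut k st)) (iota 0 m)) L.

Definition zcertified fuel ds : bool :=
  let st := zcanon (zinit ds) in let L := zexplore fuel [:: st] [:: st] in
  zmem L (zinit ds) && zclosed L.

End ZStates.

(** The fuel, 7 here and 11 for H_4, is a number of search rounds after which the list is closed
    under mutation, whatever the orientation. *)
Lemma zcertified_H3 d0 d1 : zcertified 3 7 [:: d0; d1].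
Proof. by case: d0 d1 => -[]; vm_cast_no_check (erefl true). Qed.

Lemma zcertified_H4 d0 d1 d2 : zcertified 4 11 [:: d0; d1; d2].
Proof. by case: d0 d1 d2 => -[] []; vm_cast_no_check (erefl true). Qed.

Section StateEntries.
Variable m : nat.
Implicit Types (st : zstate) (L : seq zstate).

Lemma zentry_mkseq (f : nat -> nat -> zphi) i j : (i < m + m)%N -> (j < m)%N ->
  zentry (mkseq (fun i => mkseq (f i) m) (m + m)%N) i j = f i j.
Proof. by move=> im jm; rewrite /zentry nth_mkseq // nth_mkseq. Qed.

Lemma zmem_inv L st : zmem m L st -> exists2 st', st' \in L &
  exists q : nat -> nat, [/\ forall a, (a < m)%N -> (q a < m)%N,
    forall a b, (a < m)%N -> (b < m)%N -> q a = q b -> a = b,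
    forall a b, (a < m)%N -> (b < m)%N -> zentry st a b = zentry st' (q a) (q b) &
    forall a b, (a < m)%N -> (b < m)%N -> zentry st (m + a) b = zentry st' (m + a) (q b)].
Proof.
case/and5P => inL /eqP perm uq /eqP szq /allP ltq.
exists (zcanon m st) => //; exists (nth 0%N (zranks m st)); split => a.
- by move=> am; apply: ltq; rewrite mem_nth // szq.
- by move=> b am bm /eqP; rewrite nth_uniq ?szq // => /eqP.
- move=> b am bm; rewrite -{1}perm zentry_mkseq //; last exact: leq_trans am (leq_addr _ _).
  by rewrite am.
move=> b am bm; rewrite -{1}perm zentry_mkseq ?ltn_add2l //.
by rewrite ltnNge leq_addr.
Qed.

End StateEntries.

(** * From Z[phi] to real 2 x 2 blocks *)

Section BlowUp.
Variable R : realType.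

Definition zr (z : Z) : R := (int_of_Z z)%:~R.

Lemma zrD z w : zr (Z.add z w) = zr z + zr w.
Proof. by rewrite /zr -intrD -(rmorphD int_of_Z). Qed.
Lemma zrN z : zr (Z.opp z) = - zr z.
Proof. by rewrite /zr -mulrNz -(rmorphN int_of_Z). Qed.
Lemma zrM z w : zr (Z.mul z w) = zr z * zr w.
Proof. by rewrite /zr -intrM -(rmorphM int_of_Z). Qed.
Lemma zr0 : zr Z0 = 0. Proof. by []. Qed.
Lemma zr1 : zr Z.one = 1. Proof. by rewrite /zr (rmorph1 int_of_Z). Qed.
Lemma zr_ge0 z : Z.leb Z0 z -> 0 <= zr z.
Proof. by move=> z0; rewrite /zr ler0z; lia. Qed.

(* Multiplication by z in the basis 1, phi of Z[phi]; the index [true] is phi. *)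
Definition blowup (z : zphi) (s t : bool) : R :=
  if s then (if t then zr z.1 + zr z.2 else zr z.2)
  else (if t then zr z.2 else zr z.1).

Arguments blowup : simpl never.

Lemma blowupN z s t : blowup (zopp z) s t = - blowup z s t.
Proof. by rewrite /blowup /zopp; case: s t => -[] /=; rewrite !zrN ?opprD. Qed.

Lemma blowupD z w s t : blowup (zadd z w) s t = blowup z s t + blowup w s t.
Proof. by rewrite /blowup /zadd; case: s t => -[] /=; rewrite !zrD //; ring. Qed.

Lemma blowup0 s t : blowup zzero s t = 0.
Proof. by rewrite /blowup /= zr0 addr0 !if_same. Qed.

Lemma blowup_tr z s t : blowup z s t = blowup z t s.
Proof. by case: s t => -[]. Qed.

Lemma blowupM z w s t :
  blowup (zmul z w) s t = blowup z s false * blowup w false t + blowup z s true * blowup w true t.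
Proof. by rewrite /blowup /zmul; case: s t => -[] /=; rewrite !(zrD, zrM); ring. Qed.

Lemma blowup_ge0 z s t : znonneg z -> 0 <= blowup z s t.
Proof.
by case/andP=> /zr_ge0 z1 /zr_ge0 z2; rewrite /blowup; case: s t => -[]; rewrite ?addr_ge0.
Qed.

Lemma znonnegN z : znonneg (zopp z) = znonpos z.
Proof. by rewrite /znonneg /znonpos /zopp /=; lia. Qed.

Lemma blowup_le0 z s t : znonpos z -> blowup z s t <= 0.
Proof. by rewrite -znonnegN -oppr_ge0 -blowupN; apply: blowup_ge0. Qed.

(** The left side collects the contributions of the two vertices of one fibre to a composite
    mutation. Equal signs give plus or minus the product of the blocks; opposite signs cancel. *)
Lemma blowup_mulc z w s t : znonneg z || znonpos z -> znonneg w || znonpos w ->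
  (`|blowup z s false| * blowup w false t + blowup z s false * `|blowup w false t|) / 2 +
  (`|blowup z s true| * blowup w true t + blowup z s true * `|blowup w true t|) / 2 =
  blowup (zmulc z w) s t.
Proof.
rewrite /zmulc => cz cw.
have norm x : znonneg x || znonpos x -> forall u v, `|blowup x u v| =
    (if znonneg x then 1 else -1) * blowup x u v.
  case: ifP => [x0 _|_ /= x0] u v; first by rewrite mul1r ger0_norm ?blowup_ge0.
  by rewrite mulN1r ler0_norm ?blowup_le0.
rewrite !(norm z cz) !(norm w cw).
case: (boolP (znonneg z)) (boolP (znonneg w)) cz cw => z0 [] w0 /= cz cw.
- by rewrite blowupM; field.
(* The test for a nonpositive pair still succeeds when [z] is also nonpositive; then [z] is zero and
   so are all entries of its block. *)
- rewrite cw andbT; case: ifP => [z0'|_]; last by rewrite blowup0; field.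
  have b0 u v : blowup z u v = 0.
    by apply/eqP; rewrite eq_le blowup_le0 // blowup_ge0.
  by rewrite blowupN blowupM !b0; field.
- case: ifP => [/andP[_ w0']|_]; last by rewrite blowup0; field.
  have b0 u v : blowup w u v = 0.
    by apply/eqP; rewrite eq_le blowup_le0 // blowup_ge0.
  by rewrite blowupN blowupM !b0; field.
by rewrite cz cw blowupN blowupM; field.
Qed.

Lemma blowup_coherent z s s' t : znonneg z || znonpos z -> 0 <= blowup z s t * blowup z s' t.
Proof.
by case/orP => cz; [apply: mulr_ge0; apply: blowup_ge0 | apply: mulr_le0; apply: blowup_le0].
Qed.

End BlowUp.

Lemma colH_lshift m (c : 'I_m) : colH (lshift m c) = c.
Proof. by rewrite /colH (unsplitK (inl _ c)). Qed.
Lemma colH_rshift m (c : 'I_m) : colH (rshift m c) = c.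
Proof. by rewrite /colH (unsplitK (inr _ c)). Qed.
Lemma isphi_lshift m (c : 'I_m) : isphi (lshift m c) = false.
Proof. by rewrite /isphi (unsplitK (inl _ c)). Qed.
Lemma isphi_rshift m (c : 'I_m) : isphi (rshift m c) = true.
Proof. by rewrite /isphi (unsplitK (inr _ c)). Qed.

Lemma sum_colH (R : realType) m (k : 'I_m) (f : 'I_(m + m) -> R) :
  \sum_(v | colH v == k) f v = f (lshift m k) + f (rshift m k).
Proof.
rewrite big_split_ord /=; congr (_ + _); apply: big_pred1 => v /=.
  by rewrite colH_lshift.
by rewrite colH_rshift.
Qed.

(** * Sign-coherent seeds from a mutation-closed list *)

Section HSeeds.
Variables (R : realType) (m : nat) (L : seq zstate).
Hypothesis closed : zclosed m L.

(** The list represents seeds up to relabelling only, so [p] records how the current labels sit in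
    the listed state. *)
Definition Hseed (B C : 'M[R]_(m + m)) : Prop := exists2 st, st \in L &
  exists p : nat -> nat, [/\ forall a, (a < m)%N -> (p a < m)%N,
    forall a b, (a < m)%N -> (b < m)%N -> p a = p b -> a = b,
    forall i j, B i j = blowup R (zentry st (p (colH i)) (p (colH j))) (isphi i) (isphi j) &
    forall i j, C i j = blowup R (zentry st (m + colH i) (p (colH j))) (isphi i) (isphi j)].

Lemma zgood_B st a b : zgood m st -> (a < m)%N -> (b < m)%N ->
  [/\ zentry st a b = zopp (zentry st b a), (a = b -> zentry st a b = zzero)
    & znonneg (zentry st a b) || znonpos (zentry st a b)].
Proof.
case/andP => /allP/(_ a) + _ am bm; rewrite mem_iota => /(_ am)/allP/(_ b).
rewrite mem_iota => /(_ bm)/and3P[/eqP skew diag coh]; split => // ab.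
by move: diag; rewrite ab eqxx => /eqP.
Qed.

Lemma zgood_C st b : zgood m st -> (b < m)%N ->
  (forall a, (a < m)%N -> znonneg (zentry st (m + a) b)) \/
  (forall a, (a < m)%N -> znonpos (zentry st (m + a) b)).
Proof.
case/andP => _ /allP/(_ b) + bm; rewrite mem_iota => /(_ bm)/orP[]/allP h; [left|right];
  by move=> a am; apply: h; rewrite mem_iota.
Qed.

Lemma Hseed_of_zmem st (p : nat -> nat) (B C : 'M[R]_(m + m)) :
  zmem m L st ->
  (forall a, (a < m)%N -> (p a < m)%N) ->
  (forall a b, (a < m)%N -> (b < m)%N -> p a = p b -> a = b) ->
  (forall i j, B i j = blowup R (zentry st (p (colH i)) (p (colH j))) (isphi i) (isphi j)) ->
  (forall i j, C i j = blowup R (zentry st (m + colH i) (p (colH j))) (isphi i) (isphi j)) ->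
  Hseed B C.
Proof.
move=> /zmem_inv[st' L' [q [qm qi stB stC]]] pm pi BE CE.
exists st' => //; exists (q \o p); split => [a am|a b am bm /qi/pi|i j|i j] /=.
- by rewrite qm // pm.
- by apply => //; apply: pm.
- by rewrite BE stB // pm.
- by rewrite CE stC // pm.
Qed.

Lemma Hseed_good st : st \in L -> zgood m st.
Proof. by move=> /(allP closed)/andP[]. Qed.

Lemma Hseed_skew B C : Hseed B C -> B^T = - B.
Proof.
case=> st /Hseed_good good [p [pm pi BE CE]]; apply/matrixP => i j.
rewrite !mxE !BE; have [-> _ _] := zgood_B good (pm _ (ltn_ord (colH j))) (pm _ (ltn_ord (colH i))).
by rewrite blowupN blowup_tr.
Qed.

Lemma Hseed_free B C : Hseed B C -> fibre_free (@colH m) B.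
Proof.
case=> st /Hseed_good good [p [pm pi BE CE]] i j ij.
have [_ z _] := zgood_B good (pm _ (ltn_ord (colH i))) (pm _ (ltn_ord (colH j))).
by rewrite BE z ?blowup0 // ij.
Qed.

Lemma Hseed_coherent B C : Hseed B C -> fibre_coherent (@colH m) B.
Proof.
case=> st /Hseed_good good [p [pm pi BE CE]] i i' j ii'.
have [_ _ z] := zgood_B good (pm _ (ltn_ord (colH i))) (pm _ (ltn_ord (colH j))).
by rewrite !BE -ii'; apply: blowup_coherent.
Qed.

(** The fibre of [k] consists of two vertices, and [blowup_mulc] identifies their joint effect with
    one mutation at [p k] over Z[phi], which stays in the list. *)
Lemma Hseed_step B C k : Hseed B C -> exists e, [/\ e = 1 \/ e = -1,
  sign_coherent_at (@colH m) k e C & Hseed (mutB (@colH m) k B) (mutC (@colH m) k B C)].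
Proof.
case=> st Lst [p [pm pi BE CE]]; have good := Hseed_good Lst.
have Lmut : zmem m L (zmut m (p k) st).
  by move: (allP closed _ Lst) => /andP[_ /allP]; apply; rewrite mem_iota /= add0n pm.
have pE a b : (a < m)%N -> (b < m)%N -> (p a == p b) = (a == b).
  by move=> am bm; apply/eqP/eqP => [/pi|->]; first exact.
have Bcoh a b : (a < m)%N -> (b < m)%N ->
    znonneg (zentry st (p a) (p b)) || znonpos (zentry st (p a) (p b)).
  by move=> am bm; have [] := zgood_B good (pm _ am) (pm _ bm).
have Ccoh a b : (a < m)%N -> (b < m)%N ->
    znonneg (zentry st (m + a) (p b)) || znonpos (zentry st (m + a) (p b)).
  by move=> am bm; have [] := zgood_C good (pm _ bm) => /(_ a am) ->; rewrite ?orbT.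
have step : Hseed (mutB (@colH m) k B) (mutC (@colH m) k B C).
  apply: (Hseed_of_zmem Lmut pm pi) => i j; rewrite mxE sum_colH.
    rewrite zentry_mkseq ?pm //; last exact: leq_trans (pm _ _) (leq_addr _ _).
    rewrite !pE // -!val_eqE /=; case: ifP => _; first by rewrite BE blowupN.
    rewrite blowupD !BE !colH_lshift !colH_rshift !isphi_lshift !isphi_rshift.
    by congr (_ + _); apply: blowup_mulc; apply: Bcoh.
  rewrite zentry_mkseq ?pm ?ltn_add2l // pE // -!val_eqE /=.
  rewrite (gtn_eqF (leq_trans (pm k _) (leq_addr _ _))) //=.
  case: ifP => _; first by rewrite CE blowupN.
  rewrite blowupD !BE !CE !colH_lshift !colH_rshift !isphi_lshift !isphi_rshift.
  by congr (_ + _); apply: blowup_mulc; [apply: Ccoh | apply: Bcoh].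
have [Cp|Cn] := zgood_C good (pm _ (ltn_ord k)).
  exists 1; split; [by left| |done] => i v vk.
  by rewrite mul1r CE vk blowup_ge0 // Cp.
exists (-1); split; [by right| |done] => i v vk.
by rewrite mulN1r oppr_ge0 CE vk blowup_le0 // Cn.
Qed.

End HSeeds.

(** * The initial seeds of D_6 and E_8 *)

Section HFolding.
Variables (R : realType) (m : nat) (dir : nat -> bool).
Notation phi := (2 * cos (pi / 5%:R) : R).

(** For [x = pi / 5] one has [3 x = pi - 2 x], so [cos (3 x) = - cos (2 x)]. In terms of
    [c = cos x > 0] this factors as [(c + 1) (4 c^2 - 2 c - 1) = 0]. *)
Lemma golden_ratio : phi ^+ 2 = phi + 1 /\ 0 < phi.
Proof.
set c : R := cos _.
have c_gt0 : 0 < c.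
  rewrite /c cos_gt0_pihalf //; have := pi_gt0 R => p0.
  by apply/andP; split; lra.
have c2 : cos (pi / 5%:R *+ 2) = 2 * c ^+ 2 - 1 :> R.
  by rewrite cos_mulr2n /c -mulr_natl; lra.
have c3 : cos (pi / 5%:R *+ 3) = 4 * c ^+ 3 - 3 * c :> R.
  rewrite mulrSr cosD c2 sin_mulr2n -/c.
  have s2 := cos2Dsin2 (pi / 5%:R : R); rewrite -/c in s2.
  set s := sin _ in s2 *.
  have -> : c * s *+ 2 * s = 2 * c * s ^+ 2 by rewrite -mulr_natl; ring.
  have -> : s ^+ 2 = 1 - c ^+ 2 by rewrite -s2; ring.
  by ring.
have c23 : cos (pi / 5%:R *+ 3) = - cos (pi / 5%:R *+ 2) :> R.
  have -> : pi / 5%:R *+ 3 = pi - pi / 5%:R *+ 2 :> R by move: pi => p; lra.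
  by rewrite cosB sinpi cospi mul0r addr0 mulN1r.
have eq0 : (c + 1) * (4 * c ^+ 2 - 2 * c - 1) = 0.
  transitivity ((4 * c ^+ 3 - 3 * c) + (2 * c ^+ 2 - 1)); first by ring.
  by rewrite -c3 c23 c2 addNr.
split; last by rewrite mulr_gt0.
move/eqP: eq0; rewrite mulf_eq0 => /orP[/eqP|/eqP]; first by lra.
by move=> h; rewrite exprMn; lra.
Qed.

Lemma kapH_ge0 v : 0 <= @kapH R m v.
Proof. by rewrite /kapH; case: ifP => // _; have [_ /ltW] := golden_ratio. Qed.

Let ds := mkseq dir m.-1.

Lemma nth_dir (a b : 'I_m) : a.+1 = b -> nth false ds a = dir a.
Proof.
by move=> ab; rewrite nth_mkseq // -ltnS prednK ?ab //; case: (m) b {ab} => // -[].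
Qed.

(** The block of weight 1 is the identity, giving two parallel edges; the block of phi has rows (0,
    1) and (1, 1), giving the three edges between the last two columns. *)
Lemma SH_zinit i j : SH R m dir i j =
  blowup R (zentry (zinit m ds) (colH i) (colH j)) (isphi i) (isphi j).
Proof.
rewrite zentry_mkseq //; last exact: leq_trans (ltn_ord (colH i)) (leq_addr _ _).
rewrite !mxE /arrH /edgeH.
have [ab|ab] := eqVneq (colH i).+1 (colH j).
  have -> : ((colH j).+1 == colH i) = false by apply/eqP; lia.
  rewrite (nth_dir ab) /=.
  by case: (dir _); case: ltnP => _; rewrite ?blowupN /blowup;
     case: (isphi i) (isphi j) => -[] /=; rewrite ?(zr0, zr1, subr0, sub0r, addr0, add0r, oppr0).
have [ba|ba] := eqVneq (colH j).+1 (colH i).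
  rewrite (nth_dir ba) /= ltn_ord.
  by case: (dir _); case: ltnP => _; rewrite ?blowupN /blowup;
     case: (isphi i) (isphi j) => -[] /=; rewrite ?(zr0, zr1, subr0, sub0r, addr0, add0r, oppr0).
rewrite /= subr0 ifF ?blowup0 //.
by apply/eqP; have := ltn_ord (colH i); lia.
Qed.

Lemma id_zinit i j : (1%:M : 'M[R]_(m + m)) i j =
  blowup R (zentry (zinit m ds) (m + colH i) (colH j)) (isphi i) (isphi j).
Proof.
rewrite zentry_mkseq ?ltn_add2l //.
have -> : ((m + colH i).+1 == colH j) = false.
  by apply/eqP; have := ltn_ord (colH j); lia.
have -> : (m + colH i < m)%N = false by rewrite ltnNge leq_addr.
rewrite andbF /= eqn_add2l mxE val_eqE.
case: (split_ordP i) (split_ordP j) => {i} i -> [] {j} j ->;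
  rewrite ?(colH_lshift, colH_rshift, isphi_lshift, isphi_rshift).
- by rewrite (inj_eq (@lshift_inj _ _)); case: eqP => _; rewrite ?blowup0.
- by rewrite eq_lrshift; case: eqP => _; rewrite ?blowup0.
- by rewrite eq_rlshift; case: eqP => _; rewrite ?blowup0.
rewrite (inj_eq (@rshift_inj _ _)); case: eqP => _; rewrite ?blowup0 //.
by rewrite /blowup zr0 zr1 addr0.
Qed.

(** The row vector (1, phi) is a left eigenvector of multiplication by [z], with eigenvalue the real
    value of [z]. *)
Lemma zval_blowup z t :
  blowup R z false t + phi * blowup R z true t =
  (zr R z.1 + phi * zr R z.2) * (if t then phi else 1).
Proof.
have [phi2 _] := golden_ratio; rewrite /blowup; case: t => /=; last by ring.
have -> : (zr R z.1 + phi * zr R z.2) * phi = phi * zr R z.1 + phi ^+ 2 * zr R z.2 by ring.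
by rewrite phi2; ring.
Qed.

Lemma BH_zinit a b : BH R m dir a b =
  let z := zentry (zinit m ds) a b in zr R z.1 + phi * zr R z.2.
Proof.
rewrite zentry_mkseq //; last exact: leq_trans (ltn_ord a) (leq_addr _ _).
rewrite !mxE /arrHm /=.
have last_col (u v : 'I_m) : u.+1 = v -> (u.+2 == m) = ~~ (u.+2 < m)%N.
  by move=> uv; rewrite eqn_leq -leqNgt andb_idl // => _; rewrite uv.
have [ab|ab] := eqVneq a.+1 b.
  have -> : (b.+1 == a) = false by apply/eqP; lia.
  rewrite (nth_dir ab) (last_col _ _ ab) /=.
  by case: (dir _); case: ltnP => _ /=; rewrite ?(zrN, zr0, zr1); ring.
have [ba|ba] := eqVneq b.+1 a.
  rewrite (nth_dir ba) (last_col _ _ ba) /= ltn_ord.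
  by case: (dir _); case: ltnP => _ /=; rewrite ?(zrN, zr0, zr1); ring.
rewrite /= subr0 ifF; first by rewrite !zr0; ring.
by apply/eqP; have := ltn_ord a; lia.
Qed.

Lemma fold_SH :
  fold_mx (@colH m) (@kapH R m) *m SH R m dir = BH R m dir *m fold_mx (@colH m) (@kapH R m).
Proof.
apply/matrixP => a j; rewrite fold_mulmx mulmx_fold sum_colH !SH_zinit BH_zinit.
rewrite !colH_lshift !colH_rshift /kapH !isphi_lshift !isphi_rshift mul1r.
exact: zval_blowup.
Qed.

End HFolding.

Lemma exch_of_skew (R : realType) N (w : 'I_N -> 'I_N -> R) : (exch_of w)^T = - exch_of w.
Proof. by apply/matrixP => i j; rewrite !mxE opprB. Qed.

Lemma zcertified_H m dir : (m == 3) || (m == 4) ->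
  exists2 L, zmem m L (zinit m (mkseq dir m.-1)) & zclosed m L.
Proof.
have cert fuel ds : zcertified m fuel ds ->
    exists2 L, zmem m L (zinit m ds) & zclosed m L.
  by case/andP; set L := zexplore _ _ _ _; exists L.
by case/orP=> /eqP mE; apply: cert; rewrite mE;
  [apply: zcertified_H3 | apply: zcertified_H4].
Qed.

Lemma folding_H (R : realType) m (dir : nat -> bool) ks : (m == 3) || (m == 4) ->
  let F := @colH m in let C := Cmat_comp F (SH R m dir) ks in
  let C' := Cmat (BH R m dir) ks in
  dF F (@kapH R m) (@repH m) C = C' /\ dF F (@kapH R m) (@repH m) (Gmat C) = Gmat C'.
Proof.
move=> /(zcertified_H dir)[L init closed].
apply: (@folding_theorem _ _ _ _ _ _ _ _ _ _ _ _ _ (@Hseed R m L)).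
- exact: kapH_ge0.
- by move=> b; rewrite colH_lshift.
- by move=> b; rewrite /kapH isphi_lshift.
- exact: exch_of_skew.
- exact: fold_SH.
- by apply: (Hseed_of_zmem init (p := id)) => //; [exact: SH_zinit | exact: id_zinit].
- exact: Hseed_skew.
- exact: Hseed_free.
- exact: Hseed_coherent.
- exact: Hseed_step.
Qed.

(** * Foldings onto I_2(2n+1) *)

Section MutationInvolution.
Variables (R : realType) (N N' : nat) (F : 'I_N -> 'I_N').

(** Together with [mutC_invol], this derives backward steps along the belt from forward ones. *)
Lemma mutB_invol k (B : 'M[R]_N) : mutB F k (mutB F k B) = B.
Proof.
apply/matrixP => i j; rewrite !mxE; case: ifPn => [->|/negPf ->]; first by rewrite opprK.
rewrite -addrA -big_split /= big1 ?addr0 // => v Fv.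
by rewrite !mxE Fv orbT /= !normrN; field.
Qed.

Lemma mutC_invol k (B C : 'M[R]_N) : mutC F k (mutB F k B) (mutC F k B C) = C.
Proof.
apply/matrixP => i j; rewrite !mxE; case: ifPn => [->|/negPf ->]; first by rewrite opprK.
rewrite -addrA -big_split /= big1 ?addr0 // => v Fv.
by rewrite !mxE Fv /= !normrN; field.
Qed.

Lemma sign_coherent_mutC k e (B C : 'M[R]_N) :
  sign_coherent_at F k e C -> sign_coherent_at F k (- e) (mutC F k B C).
Proof. by move=> sgn i v Fv; rewrite mxE Fv eqxx mulrNN sgn. Qed.

End MutationInvolution.

Definition adj N (i j : 'I_N) : bool := (i.+1 == j) || (j.+1 == i).

Lemma adjC N (i j : 'I_N) : adj i j = adj j i.
Proof. by rewrite /adj orbC. Qed.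

Lemma adj_odd N (i j : 'I_N) : adj i j -> odd i = ~~ odd j.
Proof. by case/orP => /eqP <-; rewrite /= ?negbK. Qed.

Lemma adj_rev N (i j : 'I_N) : adj (rev_ord i) (rev_ord j) = adj i j.
Proof.
have := ltn_ord i; have := ltn_ord j; rewrite /adj /= => iN jN.
by apply/idP/idP => /orP[]/eqP h; apply/orP; [right|left|right|left]; apply/eqP; lia.
Qed.

Lemma sum_adj (R : realType) N (f : nat -> R) (j : 'I_N) :
  \sum_(v | adj v j) f v =
  (if (0 < j)%N then f j.-1 else 0) + (if (j.+1 < N)%N then f j.+1 else 0).
Proof.
rewrite big_mkcond /= (eq_bigr (fun v : 'I_N => (if v.+1 == j then f v else 0) +
   (if j.+1 == v then f v else 0))) => [|v _]; last first.
  rewrite /adj; case: eqP => [vj|_]; last by rewrite add0r.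
  by rewrite ifF ?addr0 //; apply/eqP; lia.
rewrite big_split /=; congr (_ + _).
  case: ifP => j0; last first.
    by rewrite big1 // => v _; rewrite ifF //; apply/eqP; lia.
  have jN : (j.-1 < N)%N by have := ltn_ord j; lia.
  rewrite (bigD1 (Ordinal jN)) //= prednK // eqxx big1 ?addr0 // => v /eqP vj.
  rewrite ifF //; apply/eqP => h; apply: vj; apply/val_inj => /=; lia.
case: ifP => jN; last first.
  by rewrite big1 // => v _; rewrite ifF //; apply/eqP; have := ltn_ord v; lia.
rewrite (bigD1 (Ordinal jN)) //= eqxx big1 ?addr0 // => v /eqP vj.
by rewrite ifF //; apply/eqP => h; apply: vj; apply/val_inj.
Qed.

(** * Roots of type A along the bipartite belt *)

Section Belt.
Variables (R : realType) (h : nat).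

(* With h = 2n+1 and the coordinates eps_s indexed by s modulo 2h, s of fixed
   parity, simple roots are differences of consecutive eps_s along the order
   0 < -2 < 2 < -4 < ... or -1 < 1 < -3 < 3 < ...; [zigzag s] is the position of
   eps_s for -h <= s < 2h, and [belt t i r] is the coefficient of the r-th simple
   root in eps_(t+i) - eps_(t-i-2). *)
Definition zigzag (s : int) : int :=
  if s < 0 then - s - 1 else if s < h%:Z then s else h%:Z *+ 2 - s - 1.

Definition below (r : nat) (s : int) : bool := r%:Z < zigzag s.

Definition belt (t i r : nat) : R :=
  (below r (t%:Z + i%:Z))%:R - (below r (t%:Z - i%:Z - 2))%:R.

(** Times 0 and 1 carry the negative and the positive simple roots, which together make the C-matrix
    at time 0 the identity. *)
Lemma belt0 i r : (i.+1 < h)%N -> belt 0 i r = - (r == i)%:R.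
Proof.
move=> *; rewrite /belt.
have -> : below r (0%N%:Z + i%:Z) = (r < i)%N.
  by rewrite /below /zigzag; do 2?case: ifP => ?; apply/idP/idP; lia.
have -> : below r (0%N%:Z - i%:Z - 2) = (r <= i)%N.
  by rewrite /below /zigzag; do 2?case: ifP => ?; apply/idP/idP; lia.
by case: ltngtP => _ /=; rewrite ?(subrr, oppr0, subr0, sub0r).
Qed.

Lemma belt1 i r : (i.+1 < h)%N -> belt 1 i r = (r == i)%:R.
Proof.
move=> *; rewrite /belt.
have -> : below r (1%N%:Z + i%:Z) = (r <= i)%N.
  by rewrite /below /zigzag; do 2?case: ifP => ?; apply/idP/idP; lia.
have -> : below r (1%N%:Z - i%:Z - 2) = (r < i)%N.
  by rewrite /below /zigzag; do 2?case: ifP => ?; apply/idP/idP; lia.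
by case: ltngtP => _ /=; rewrite ?(subrr, oppr0, subr0, sub0r).
Qed.

(** At these times [t - i - 2] comes no later than [t + i] in the zigzag order. *)
Lemma belt_ge0 t i r : (i.+1 < h)%N -> (0 < t <= h)%N -> 0 <= belt t i r.
Proof.
move=> ih th; rewrite /belt subr_ge0 ler_nat.
suff : below r (t%:Z - i%:Z - 2) -> below r (t%:Z + i%:Z).
  by case: (below _ _) (below _ _) => [] [] // /(_ isT).
by move=> /lt_le_trans; apply; rewrite /zigzag; do 4?case: ifP => ?; lia.
Qed.

(** At time [h] the simple roots reappear, permuted by the reversal of the path. *)
Lemma belt_h i r : (i.+1 < h)%N -> (r.+1 < h)%N -> belt h i r = (r == (h - i.+2)%N)%:R.
Proof.
move=> *; rewrite /belt.
have -> : below r (h%:Z + i%:Z) = (r <= h - i.+2)%N.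
  by rewrite /below /zigzag; do 2?case: ifP => ?; apply/idP/idP; lia.
have -> : below r (h%:Z - i%:Z - 2) = (r < h - i.+2)%N.
  by rewrite /below /zigzag; do 2?case: ifP => ?; apply/idP/idP; lia.
by case: ltngtP => _ /=; rewrite ?(subrr, oppr0, subr0, sub0r).
Qed.

Lemma belt_hS i r : (i.+1 < h)%N -> (r.+1 < h)%N -> belt h.+1 i r = - (r == (h - i.+2)%N)%:R.
Proof.
move=> *; rewrite /belt.
have -> : below r (h.+1%:Z + i%:Z) = (r < h - i.+2)%N.
  by rewrite /below /zigzag; do 2?case: ifP => ?; apply/idP/idP; lia.
have -> : below r (h.+1%:Z - i%:Z - 2) = (r <= h - i.+2)%N.
  by rewrite /below /zigzag; do 2?case: ifP => ?; apply/idP/idP; lia.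
by case: ltngtP => _ /=; rewrite ?(subrr, oppr0, subr0, sub0r).
Qed.

(* Both sides telescope to the same four eps terms; at the end of the path the
   missing neighbour contributes zero by reflection at 0 and by 2h-periodicity. *)
Lemma belt_wave N t r (j : 'I_N) : h = N.+1 -> (t < h)%N ->
  \sum_(v | adj v j) belt t.+1 v r = belt t.+2 j r + belt t j r.
Proof.
move=> hN th; rewrite (sum_adj (fun v => belt t.+1 v r)).
have := ltn_ord j; move: (nat_of_ord j) => {}j jN.
have -> : (if (0 < j)%N then belt t.+1 j.-1 r else 0) =
  (below r (t%:Z + j%:Z))%:R - (below r (t%:Z - j%:Z))%:R.
  case: ifP => j0; last by rewrite (_ : j = 0%N) ?addr0 ?subr0 ?subrr //; lia.
  by rewrite /belt; congr ((below _ _)%:R - (below _ _)%:R); lia.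
have -> : (if (j.+1 < N)%N then belt t.+1 j.+1 r else 0) =
  (below r (t.+2%:Z + j%:Z))%:R - (below r (t%:Z - j%:Z - 2))%:R.
  case: ifP => j0.
    by rewrite /belt; congr ((below _ _)%:R - (below _ _)%:R); lia.
  apply/esym/eqP; rewrite subr_eq0; apply/eqP; congr (_%:R); rewrite /below; congr (_ < _).
  by rewrite /zigzag; do 4?case: ifP => ?; lia.
rewrite /belt; have -> : t.+2%:Z - j%:Z - 2 = t%:Z - j%:Z by lia.
by rewrite addrC addrACA [in RHS]addrACA; ring.
Qed.

End Belt.

(** * The seeds of the belt and their mutations *)

Section BipartiteSeeds.
Variables (R : realType) (n : nat) (src : bool).
Local Notation N := n.*2.
Local Notation h := n.*2.+1.
Local Notation F := (@FI n).

Definition flip (s : bool) (i : 'I_N) : 'I_N := if s then rev_ord i else i.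

(** Tells the sources from the sinks. Each step reverses all arrows, hence [odd t]; reversing a path
    with an even number of vertices swaps parities, hence [s]. *)
Definition outgoing (t : nat) (s : bool) (i : nat) : bool :=
  (odd i (+) s (+) odd t) != src.

Definition beltB t s : 'M[R]_N :=
  \matrix_(i, j) if adj i j then (if outgoing t s i then 1 else -1) else 0.

(* The times t <= h are reached by mutating at positive columns (the last of them
   has C = - permutation); from there two mutations at negative columns lead back
   to the initial seed, relabelled by [rev_ord], which [s] records. *)
Definition beltC t s : 'M[R]_N := \matrix_(r, i)
  if (t <= h)%N then
    (if outgoing t s i then belt R h t.+1 (flip s i) r else - belt R h t (flip s i) r)
  else (if outgoing t s i then - (r == flip (~~ s) i)%:R else (r == flip (~~ s) i)%:R).

Lemma FI_eq (i j : 'I_N) : (F i == F j) = (odd i == odd j).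
Proof. by rewrite -val_eqE /= !modn2; case: (odd i) (odd j) => [] []. Qed.

Lemma FI_odd (i : 'I_N) (k : 'I_2) : (F i == k) = (odd i == odd k).
Proof. by rewrite -val_eqE /= modn2; case: (odd i) k => -[[|[|]]]. Qed.

Lemma adj_flip s (i j : 'I_N) : adj (flip s i) (flip s j) = adj i j.
Proof. by case: s => //; apply: adj_rev. Qed.

Lemma flip_inj s : injective (flip s).
Proof. by case: s => //; apply: rev_ord_inj. Qed.

Lemma adj_outgoing t s (i j : 'I_N) : adj i j -> outgoing t s i = ~~ outgoing t s j.
Proof.
move=> /adj_odd; rewrite /outgoing => ->.
by case: (odd j) s (odd t) src => [] [] [] [].
Qed.

Lemma outgoingS t s i : outgoing t.+1 s i = ~~ outgoing t s i.
Proof. by rewrite /outgoing /=; case: (odd i) s (odd t) src => [] [] [] []. Qed.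

Lemma outgoing_odd t s (i j : nat) : odd i = odd j -> outgoing t s i = outgoing t s j.
Proof. by rewrite /outgoing => ->. Qed.

(** Every vertex is a source or a sink, so no directed path of length two exists and mutation at
    either class only reverses arrows. *)
Lemma mutB_belt t s k : mutB F k (beltB t s) = beltB t.+1 s.
Proof.
apply/matrixP => i j; rewrite !mxE outgoingS.
case: ifPn => [_|]; first by case: ifP; case: outgoing; rewrite ?opprK ?oppr0.
rewrite !FI_odd negb_or => /andP[ik jk]; rewrite ifF; last first.
  by apply/negP => /adj_odd; move: ik jk; case: (odd i) (odd j) (odd k) => [] [] [].
rewrite add0r big1 => [|v]; last first.
  rewrite FI_odd => /eqP vk; rewrite !mxE.
  have iv : outgoing t s i = ~~ outgoing t s v.
    by rewrite /outgoing vk; move: ik; case: (odd i) (odd k) s (odd t) src => [] [] [] [] [].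
  rewrite iv; case: (adj i v) (adj v j) (outgoing t s v) => [] [] [] /=;
    rewrite ?normrN1 ?normr1 ?normr0; ring.
rewrite ifF //.
by apply/negP => /adj_odd; move: ik jk; case: (odd i) (odd j) (odd k) => [] [] [].
Qed.

Section Forward.
Variables (t : nat) (s : bool) (k : 'I_2).
Hypothesis out_k : outgoing t s k.

Lemma outgoing_fibre (v : 'I_N) : outgoing t s v = (F v == k).
Proof.
rewrite FI_odd; move: out_k; rewrite /outgoing.
by case: (odd v) (odd k) s (odd t) src => [] [] [] [] [].
Qed.

(** The fibre is the class of sources, whose entries towards neighbours are 1. Nonnegative columns
    there are added to the neighbouring columns; nonpositive ones, treated next, contribute
    nothing. *)
Lemma mutC_outgoing_pos (C : 'M[R]_N) : sign_coherent_at F k 1 C ->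
  mutC F k (beltB t s) C = \matrix_(r, j)
    if outgoing t s j then - C r j else C r j + \sum_(v | adj v j) C r v.
Proof.
move=> sgn; apply/matrixP => r j; rewrite !mxE -outgoing_fibre.
case: ifPn => // jk; congr (_ + _).
rewrite [RHS]big_mkcond [LHS]big_mkcond; apply: eq_bigr => v _ /=.
rewrite !mxE outgoing_fibre; case: ifPn => [/eqP vk|vk]; last first.
  rewrite ifF //; apply/negP => /(adj_outgoing t s).
  by rewrite outgoing_fibre (negPf jk) (negPf vk).
have := sgn r v vk; rewrite mul1r => Cv; rewrite ger0_norm //.
by rewrite vk eqxx; case: ifP => _; rewrite ?normr1 ?normr0; field.
Qed.

Lemma mutC_outgoing_neg (C : 'M[R]_N) : sign_coherent_at F k (-1) C ->
  mutC F k (beltB t s) C = \matrix_(r, j) if outgoing t s j then - C r j else C r j.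
Proof.
move=> sgn; apply/matrixP => r j; rewrite !mxE -outgoing_fibre.
case: ifPn => // jk; rewrite big1 ?addr0 // => v /eqP vk.
have := sgn r v vk; rewrite mulN1r oppr_ge0 => Cv; rewrite ler0_norm //.
rewrite !mxE outgoing_fibre vk eqxx.
by case: ifP => _; rewrite ?normr1 ?normr0; field.
Qed.

End Forward.

Lemma flip_lt s (i : 'I_N) : ((flip s i).+1 < h)%N.
Proof. by rewrite ltnS. Qed.

Lemma rev_flip s (i : 'I_N) : (h - (flip s i).+2)%N = flip (~~ s) i.
Proof. by have := ltn_ord i; case: s => /=; lia. Qed.

Lemma belt_forward_pos t s (k : 'I_2) : (t < h)%N -> outgoing t s k ->
  sign_coherent_at F k 1 (beltC t s) /\
  mutC F k (beltB t s) (beltC t s) = beltC t.+1 s.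
Proof.
move=> th out_k; have sgn : sign_coherent_at F k 1 (beltC t s).
  move=> r v /eqP vk; rewrite mul1r mxE (outgoing_fibre out_k) vk ltnW //.
  by apply: belt_ge0; rewrite ?flip_lt.
split=> //; rewrite mutC_outgoing_pos //; apply/matrixP => r j.
rewrite !mxE th ltnW // outgoingS; case: (boolP (outgoing t s j)) => //= jk.
rewrite (eq_bigr (fun v => belt R h t.+1 (flip s v) r)) => [|v /(adj_outgoing t s) vj]; last first.
  by rewrite !mxE ltnW // vj (negPf jk).
have -> : \sum_(v | adj v j) belt R h t.+1 (flip s v) r =
    \sum_(v | adj v (flip s j)) belt R h t.+1 v r.
  rewrite [RHS](reindex_inj (@flip_inj s)) /=.
  by apply: eq_bigl => v; rewrite adj_flip.
(* The wave relation turns minus the root at time [t] plus the neighbouring roots at [t + 1] into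
   the root at [t + 2]. *)
by rewrite (@belt_wave _ _ N) // addrC addrK.
Qed.

Lemma belt_forward_h s (k : 'I_2) : outgoing h s k ->
  sign_coherent_at F k (-1) (beltC h s) /\
  mutC F k (beltB h s) (beltC h s) = beltC h.+1 s.
Proof.
move=> out_k; have sgn : sign_coherent_at F k (-1) (beltC h s).
  move=> r v /eqP vk; rewrite mulN1r mxE (outgoing_fibre out_k) vk leqnn.
  by rewrite belt_hS ?opprK ?ler0n ?ltnS.
split=> //; rewrite mutC_outgoing_neg //; apply/matrixP => r j.
have fj : (r == flip (~~ s) j) = (r == (h - (flip s j).+2)%N :> nat).
  by rewrite rev_flip val_eqE.
rewrite !mxE leqnn ltnn (outgoingS h s) fj.
by case: (boolP (outgoing h s j)) => _ /=; rewrite ?belt_hS ?belt_h ?opprK ?ltnS.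
Qed.

Lemma belt_forward_last s (k : 'I_2) : outgoing h.+1 s k ->
  sign_coherent_at F k (-1) (beltC h.+1 s) /\
  mutC F k (beltB h.+1 s) (beltC h.+1 s) = beltC 0 (~~ s).
Proof.
move=> out_k; have sgn : sign_coherent_at F k (-1) (beltC h.+1 s).
  move=> r v /eqP vk; rewrite mulN1r mxE (outgoing_fibre out_k) vk ltnn.
  by rewrite opprK ler0n.
split=> //; rewrite mutC_outgoing_neg //; apply/matrixP => r j.
rewrite !mxE ltnn leq0n; have fj := flip_lt (~~ s) j.
by rewrite belt1 // belt0 // opprK; case: (boolP (outgoing h.+1 s j)) => _; rewrite ?opprK if_same.
Qed.

Lemma outgoing_last s i : outgoing h.+2 s i = outgoing 0 (~~ s) i.
Proof. by rewrite /outgoing /= odd_double; case: (odd i) s src => [] [] []. Qed.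

Lemma beltB_last s : beltB h.+2 s = beltB 0 (~~ s).
Proof. by apply/matrixP => i j; rewrite !mxE outgoing_last. Qed.

(** The belt is a cycle: [h + 2] steps reverse the labels, and twice as many close it up. *)
Definition belt_next (p : nat * bool) : nat * bool :=
  if (p.1 <= h)%N then (p.1.+1, p.2) else (0%N, ~~ p.2).
Definition belt_prev (p : nat * bool) : nat * bool :=
  if p.1 is t.+1 then (t, p.2) else (h.+1, ~~ p.2).

Lemma belt_prevK p : (p.1 <= h.+1)%N -> belt_next (belt_prev p) = p.
Proof. by case: p => -[|t] s /= th; rewrite /belt_next /= ?ltnn ?negbK // -ltnS th. Qed.

Lemma belt_next_le p : ((belt_next p).1 <= h.+1)%N.
Proof. by rewrite /belt_next; case: ifP. Qed.

Lemma belt_prev_le p : (p.1 <= h.+1)%N -> ((belt_prev p).1 <= h.+1)%N.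
Proof. by case: p => -[|t] s //= /ltnW. Qed.

Lemma belt_forward p (k : 'I_2) : (p.1 <= h.+1)%N -> outgoing p.1 p.2 k ->
  exists e, [/\ e = 1 \/ e = -1, sign_coherent_at F k e (beltC p.1 p.2),
    mutB F k (beltB p.1 p.2) = beltB (belt_next p).1 (belt_next p).2 &
    mutC F k (beltB p.1 p.2) (beltC p.1 p.2) = beltC (belt_next p).1 (belt_next p).2].
Proof.
case: p => t s /= th out_k; rewrite mutB_belt /belt_next /=.
have [t_lt|t_ge] := ltnP t h.
  have [sgn mut] := belt_forward_pos t_lt out_k.
  by exists 1; rewrite ltnW //; split=> //; left.
move: th; rewrite leq_eqVlt => /orP[/eqP tE|th].
  subst t; have [sgn mut] := belt_forward_last out_k.
  by exists (-1); rewrite ltnn; split=> //; [right | exact: beltB_last].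
have tE : t = h by apply/eqP; rewrite eqn_leq t_ge -ltnS th.
subst t; have [sgn mut] := belt_forward_h out_k.
by exists (-1); rewrite leqnn; split=> //; right.
Qed.

Lemma outgoing_prev p (k : 'I_2) : (p.1 <= h.+1)%N ->
  ~~ outgoing p.1 p.2 k -> outgoing (belt_prev p).1 (belt_prev p).2 k.
Proof.
case: p => -[|t] s /= th; last by rewrite outgoingS negbK.
by rewrite /outgoing /= odd_double; case: (odd k) s src => [] [] [].
Qed.

Definition belt_seed (B C : 'M[R]_N) : Prop :=
  exists2 p : nat * bool, (p.1 <= h.+1)%N & B = beltB p.1 p.2 /\ C = beltC p.1 p.2.

(** If class [k] consists of sources, this is a forward step. Otherwise it undoes the forward step
    at [k] from the preceding seed, and the sign is reversed. *)
Lemma belt_seed_step B C k : belt_seed B C -> exists e, [/\ e = 1 \/ e = -1,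
  sign_coherent_at F k e C & belt_seed (mutB F k B) (mutC F k B C)].
Proof.
case=> p ph [-> ->]; have [out_k|in_k] := boolP (outgoing p.1 p.2 k).
  have [e [e1 sgn mB mC]] := belt_forward ph out_k.
  by exists e; split=> //; exists (belt_next p); rewrite ?belt_next_le.
have [e [e1 sgn mB mC]] := belt_forward (belt_prev_le ph) (outgoing_prev ph in_k).
rewrite belt_prevK // in mB mC.
exists (- e); rewrite -mB -mC; split.
- by case: e1 => ->; [right | left; rewrite opprK].
- exact: sign_coherent_mutC.
- by rewrite mutB_invol mutC_invol; exists (belt_prev p); rewrite ?belt_prev_le.
Qed.

Lemma belt_seed_skew B C : belt_seed B C -> B^T = - B.
Proof.
case=> p ph [-> _]; apply/matrixP => i j; rewrite !mxE adjC.
case: ifP => [/(adj_outgoing p.1 p.2) ->|_]; last by rewrite oppr0.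
by case: outgoing; rewrite /= ?opprK.
Qed.

Lemma belt_seed_free B C : belt_seed B C -> fibre_free F B.
Proof.
case=> p ph [-> _] i j /eqP; rewrite FI_eq mxE => ij.
by rewrite ifF //; apply/negP => /adj_odd; move: ij; case: (odd i) (odd j) => [] [].
Qed.

Lemma belt_seed_coherent B C : belt_seed B C -> fibre_coherent F B.
Proof.
case=> p ph [-> _] i i' j /eqP; rewrite FI_eq !mxE => /eqP/outgoing_odd ->.
by do 3?case: ifP => _; rewrite ?mulr0 ?mul0r ?mulr1 ?mulrNN ?mulr1.
Qed.

Lemma SI_belt : SI R n src = beltB 0 false.
Proof.
apply/matrixP => i j; rewrite !mxE /arrA -/(adj i j) -/(adj j i) [adj j i]adjC.
rewrite /outgoing !addbF; have [/adj_odd ->|_] := boolP (adj i j); last by rewrite subrr.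
by case: (odd j) src => [] [] /=; rewrite ?subr0 ?sub0r.
Qed.

Lemma belt_seed0 : belt_seed (SI R n src) 1%:M.
Proof.
exists (0%N, false) => //=; split; first exact: SI_belt.
apply/matrixP => i j; rewrite !mxE /=.
by rewrite belt1 ?ltnS // belt0 ?ltnS // opprK if_same.
Qed.

End BipartiteSeeds.

(** * Chebyshev weights on the path *)

Section ChebyshevFolding.
Variables (R : realType) (n : nat) (src : bool).
Hypothesis n_gt1 : (2 <= n)%N.
Notation theta := (pi / (n.*2.+1)%:R : R).

Lemma chebU_sin (x : R) k : chebU k (cos x) * sin x = sin (k.+1%:R * x).
Proof.
have [] : chebU k (cos x) * sin x = sin (k.+1%:R * x) /\
          chebU k.+1 (cos x) * sin x = sin (k.+2%:R * x); last by [].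
elim: k => [|k [IH0 IH1]].
  split; first by rewrite !mul1r.
  by rewrite /= [2%:R * x]mulr_natl sin_mulr2n -[RHS]mulr_natl; ring.
split=> //.
have -> : chebU k.+2 (cos x) * sin x =
    2 * cos x * (chebU k.+1 (cos x) * sin x) - chebU k (cos x) * sin x by rewrite /=; ring.
rewrite IH0 IH1.
have -> : k.+3%:R * x = k.+2%:R * x + x by rewrite [k.+3%:R]mulrSr mulrDl mul1r.
have -> : k.+1%:R * x = k.+2%:R * x - x by rewrite [k.+2%:R]mulrSr mulrDl mul1r addrK.
by rewrite sinB sinD; ring.
Qed.

Lemma theta_natr k : (k <= n.*2.+1)%N -> 0 <= k%:R * theta <= pi.
Proof.
move=> kh; have p0 := pi_ge0 R; have h0 : 0 < n.*2.+1%:R :> R by rewrite ltr0n.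
rewrite mulr_ge0 ?divr_ge0 ?ler0n //= mulrCA ger_pMr ?pi_gt0 //.
by rewrite ler_pdivrMr // mul1r ler_nat.
Qed.

Lemma sin_theta_gt0 : 0 < sin theta.
Proof.
rewrite sin_gt0_pi // divr_gt0 ?pi_gt0 ?ltr0n //= ltr_pdivrMr ?ltr0n //.
by rewrite ltr_pMr ?pi_gt0 // ltr1n; lia.
Qed.

Lemma kapI_ge0 i : 0 <= @kapI R n i.
Proof.
rewrite -(pmulr_lge0 _ sin_theta_gt0) /kapI chebU_sin sin_ge0_pi //.
by apply: theta_natr; apply: ltnW; rewrite ltnS.
Qed.

(** As [(2n+1) theta = pi], the sines of [2n theta] and of [theta] agree. *)
Lemma chebU_last : chebU (n.*2).-1 (cos theta) = 1.
Proof.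
apply: (mulIf (lt0r_neq0 sin_theta_gt0)); rewrite chebU_sin mul1r prednK; last by lia.
have -> : n.*2%:R * theta = pi - theta.
  by rewrite -[n.*2%:R](addrK 1) -mulrSr mulrBl mul1r mulrCA divff ?mulr1 // pnatr_eq0.
by rewrite sinB sinpi cospi mul0r sub0r mulN1r opprK.
Qed.

Lemma chebU_vanish : chebU n.*2 (cos theta) = 0.
Proof.
apply: (mulIf (lt0r_neq0 sin_theta_gt0)); rewrite chebU_sin mul0r mulrCA divff ?mulr1 ?sinpi //.
by rewrite pnatr_eq0.
Qed.

(** The Chebyshev recurrence makes the weights an eigenvector of the adjacency matrix of the path;
    at the far end the missing neighbour has weight [U_{2n} = 0] by [chebU_vanish]. *)
Lemma sum_adj_kapI (j : 'I_(n.*2)) :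
  \sum_(i | adj i j) @kapI R n i = 2 * cos theta * @kapI R n j.
Proof.
rewrite (sum_adj (fun i => chebU i (cos theta))) /kapI.
have -> : (if (j.+1 < n.*2)%N then chebU j.+1 (cos theta) else 0) = chebU j.+1 (cos theta).
  case: ifPn => // jN; have -> : j.+1 = n.*2 by apply/eqP; rewrite eqn_leq ltn_ord leqNgt.
  by rewrite chebU_vanish.
by case: (nat_of_ord j) => [|i] /=; ring.
Qed.

Lemma BI_entry a b : BI R n src a b =
  if a != b then (if odd a != src then 1 else -1) * (2 * cos theta) else 0.
Proof.
rewrite !mxE /arrI2 [b == a]eq_sym; case: (eqVneq a b) => [|] /=; first by rewrite subrr.
case: a b => -[|[|//]] ? [[|[|//]] ?] // _; case: src => /=; rewrite ?subr0 ?sub0r; ring.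
Qed.

Lemma fold_SI : fold_mx (@FI n) (@kapI R n) *m SI R n src =
  BI R n src *m fold_mx (@FI n) (@kapI R n).
Proof.
apply/matrixP => a j; rewrite fold_mulmx mulmx_fold SI_belt BI_entry eq_sym FI_odd.
case: ifPn => [ja|]; last first.
  rewrite negbK => /eqP ja; rewrite mul0r big1 // => i; rewrite FI_odd mxE => /eqP ia.
  rewrite ifF ?mulr0 //; apply/negP => /adj_odd; rewrite ia ja.
  by case: (odd a).
(* For [j] outside the fibre of [a], the eigenvector equation is the required identity up to a sign
   depending only on [a]. *)
rewrite -mulrA -sum_adj_kapI mulr_sumr [LHS]big_mkcond [RHS]big_mkcond.
apply: eq_bigr => i _; rewrite FI_odd mxE.
case: (boolP (adj i j)) => [/adj_odd|_]; last by rewrite mulr0 if_same.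
rewrite /outgoing !addbF => ij; have -> : odd i = odd a.
  by rewrite ij; move: ja; case: (odd j) (odd a) => [] [].
by rewrite eqxx mulrC.
Qed.

Lemma folding_I ks :
  let F := @FI n in let C := Cmat_comp F (SI R n src) ks in
  let C' := Cmat (BI R n src) ks in
  dF F (@kapI R n) (repI n_gt1) C = C' /\ dF F (@kapI R n) (repI n_gt1) (Gmat C) = Gmat C'.
Proof.
apply: (@folding_theorem _ _ _ _ _ _ _ _ _ _ _ _ _ (@belt_seed R n src)).
- exact: kapI_ge0.
- move=> b; apply/eqP; rewrite FI_odd /repI; case: b => -[|[|//]] ? //=.
  by have := n_gt1; lia.
- move=> b; rewrite /repI /kapI; case: ifP => _ //=; exact: chebU_last.
- exact: exch_of_skew.
- exact: fold_SI.
- exact: belt_seed0.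
- exact: belt_seed_skew.
- exact: belt_seed_free.
- exact: belt_seed_coherent.
- exact: belt_seed_step.
Qed.

End ChebyshevFolding.

Theorem theorem8p4 (R : realType) (N N' : nat) (F : 'I_N -> 'I_N')
  (kap : 'I_N -> R) (rep : 'I_N' -> 'I_N) (S : 'M[R]_N) (B' : 'M[R]_N') :
  context_folding F kap rep S B' ->
  forall ks : seq 'I_N',
    dF F kap rep (Cmat_comp F S ks) = Cmat B' ks /\
    dF F kap rep (Gmat (Cmat_comp F S ks)) = Gmat (Cmat B' ks).
Proof.
case=> [n n_gt1 src|m m34 dir] ks; first exact: folding_I.
exact: folding_H.
Qed.
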